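(* Let $\psi:[0,1]\to\mathbb{R}^+$ be convex and increasing, continuous on $[0,1]$ and twice differentiable on $(0,1)$, with $\psi(0)=0=\psi'(0)$ and $\psi''(\theta)>0$ for $0<\theta<1$. Let $G(\eta):=\inf_{0\le\theta\le1}\bigl(\psi(1-\theta)+\theta\eta\bigr)$ for $\eta\in[0,\infty)$ and $G(\infty):=\psi(1)$. Let $r_0>0$ and let $\xi:[0,r_0]\to\mathbb{R}^+\cup\{\infty\}$ be continuous on $[0,r_0]$ and (finite and) twice differentiable on $(0,r_0)$. Suppose there exists a finite constant $c$ such that $$ \xi''(r)\le c\,\xi'(r)^2\quad\text{for } 0<r<r_0 $$ and $$ \psi''(1-\theta)\le \frac{1}{\theta^2+\theta c}\quad\text{for } 0<\theta<1 . $$ Then the function $r\mapsto\exp\bigl(G(\xi(r))\bigr)$ is concave on $[0,r_0]$.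
   Context: $\mathbb{R}^+=[0,\infty)$, and $\mathbb{R}^+\cup\{\infty\}$ carries its usual topology as $[0,\infty]$. $\psi'(0)$ is the right-hand derivative at $0$. *)

(* Defs.v *)
From mathcomp Require Import all_boot all_order all_algebra.
From mathcomp Require Import all_classical all_reals all_analysis.

Set Implicit Arguments.
Unset Strict Implicit.
Unset Printing Implicit Defensive.

Import Order.TTheory GRing.Theory Num.Theory.
Import numFieldNormedType.Exports.

Local Open Scope classical_set_scope.
Local Open Scope ring_scope.

Definition concave_function (R : numFieldType) (E : lmodType R)
    (D : set (convex_lmodType E)) (f : convex_lmodType E -> R^o) : Prop :=
  convex_function D (fun x => - f x).

Definition twice_derivable_on (R : realType) (D : set R) (f : R -> R) : Prop :=
  forall x, D x -> derivable f x 1 /\ derivable f^`()%classic x 1.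

(* G is only meaningful on [0, +oo]: the value at -oo is a dummy. *)
Definition G (R : realType) (psi : R -> R) (eta : \bar R) : R :=
  match eta with
  | EFin e => inf [set psi (1 - theta) + theta * e | theta in `[0, 1]]
  | +oo%E => psi 1
  | -oo%E => 0
  end.

(* Main.v *)
Require Import Defs.
From mathcomp Require Import all_boot all_order all_algebra.
From mathcomp Require Import all_classical all_reals all_analysis.
From mathcomp Require Import ring lra.

Import Order.TTheory GRing.Theory Num.Theory.
Import numFieldNormedType.Exports.

Local Open Scope classical_set_scope.
Local Open Scope ring_scope.

(* A continuous function [F] is concave as soon as at each interior point it is
   touched from above by a function with nonpositive second derivative there:
   otherwise [F] minus a chord plus a small multiple of [(s - x) * (y - s)] has
   an interior minimum, which contradicts the second derivative test.

   For [F = exp (G (xi))] the touching functions come from the infimum defining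
   [G]: any path [th] in [0, 1] gives [G (xi) <= psi (1 - th) + th * xi], with
   equality at [r] if [th r] is a minimizer [t] for [xi r].  If [t = 0], take
   [th = 0]: the majorant is constant.  If [t = 1], then [psi'(0) = 0] forces
   [xi r = 0], so [xi] has a minimum at [r] and [th = 1] works.  If [0 < t < 1],
   an affine [th] of slope [- xi'(r) / psi''(1 - t)] works by the hypotheses
   on [xi''] and [psi'']; [G] itself need not be differentiated. *)

(** * Concavity from local majorants *)

(** If [d < 0], then [df], which vanishes at the minimum [x], is negative just to its right, and the
    mean value theorem makes [f] drop below [f x] there. *)
Lemma second_derivative_ge0_at_min {R : realType} {f df : R -> R} {x d : R} :
  (\forall s \near x, is_derive (s : R) (1 : R) f (df s)) -> is_derive x 1 df d ->
  (\forall s \near x, f x <= f s) -> 0 <= d.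
Proof.
move=> f_df df_d f_min; rewrite leNgt; apply/negP => d_lt0.
have [e /= e0 fe] : exists2 e : R, 0 < e &
    forall s, `|x - s| < e -> is_derive (s : R) (1 : R) f (df s) /\ f x <= f s.
  have /nbhs_ballP[e /= e0 he] : \forall s \near x,
      is_derive (s : R) (1 : R) f (df s) /\ f x <= f s.
    by near=> s; split; near: s.
  by exists e.
have near_ball s : s \in `]x - e, x + e[ -> `|x - s| < e.
  by rewrite in_itv/= => /andP[? ?]; rewrite ltr_norml; apply/andP; split; lra.
have dfx0 : df x = 0.
  have f'0 : is_derive x 1 f 0.
    apply: (@derive1_at_min _ f (x - e) (x + e)).
    - lra.
    - by move=> t /near_ball/fe[] [].
    - by rewrite in_itv/=; lra.
    - by move=> t /near_ball/fe[].
  have [[_ <-] _] := fe x ltac:(by rewrite subrr normr0).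
  exact: derive_val.
(* Since [df x = 0], the difference quotient tending to [d] is [df (x + h) / h], so [df (x + h)]
   takes the sign of [d] for small [h > 0]. *)
have [k /= k0 hk] : exists2 k : R, 0 < k &
    forall h, 0 < h < k -> df (x + h) < 0.
  have [dfx dE] := df_d; rewrite -dE in d_lt0.
  have /cvgr_lt/(_ _ d_lt0) : h^-1 *: (df (h *: 1 + x) - df x) @[h --> 0^'] --> 'D_1 df x.
    exact: dfx.
  move=> /nbhs_ballP[k /= k0 hk].
  exists k => // h /andP[h0 hk'].
  have := hk h; rewrite /ball/= sub0r normrN gtr0_norm// => /(_ hk').
  move=> /(_ ltac:(by rewrite gt_eqF)).
  by rewrite dfx0 subr0 [_ *: 1]mulr1 addrC pmulr_rlt0// invr_gt0.
pose h := Num.min e k / 2.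
have [h0 he hk'] : [/\ 0 < h, h < e & h < k].
  have m0 : 0 < Num.min e k by rewrite lt_min e0.
  have me : Num.min e k <= e by rewrite ge_min lexx.
  have mk : Num.min e k <= k by rewrite ge_min lexx orbT.
  by rewrite /h; split; lra.
have xxh : x < x + h by lra.
have inball s : s \in `[x, x + h] -> `|x - s| < e.
  by rewrite in_itv/= => /andP[? ?]; rewrite ltr_norml; apply/andP; split; lra.
have [||c] := @MVT _ f df _ _ xxh.
- by move=> s /subset_itv_oo_cc/inball/fe[].
- by apply: derivable_within_continuous => s /inball/fe[] [].
rewrite in_itv/= => /andP[xc ch] fE.
have := hk (c - x); rewrite [x + _]addrC subrK => /(_ ltac:(lra)) dfc.
have /inball/fe[_ fxh] : x + h \in `[x, x + h] by rewrite in_itv/= lexx andbT; lra.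
have : df c * (x + h - x) < 0 by rewrite pmulr_llt0//; lra.
by rewrite -fE; lra.
Unshelve. all: by end_near. Qed.

(** The second derivative is controlled at the single point [x]: [g] may fail to be concave nearby,
    and [f] may fail to be differentiable. *)
Definition has_concave_majorant {R : realType} (f : R -> R) (x : R) : Prop :=
  exists (g dg : R -> R) (ddg : R),
    [/\ f x = g x, \forall s \near x, f s <= g s,
        \forall s \near x, is_derive (s : R) (1 : R) g (dg s),
        is_derive x 1 dg ddg & ddg <= 0].

Lemma concave_of_majorants {R : realType} {f : R -> R} {a b : R} :
  {within `[a, b], continuous f} ->
  (forall x, x \in `]a, b[ -> has_concave_majorant f x) ->
  forall x y t, x \in `[a, b] -> y \in `[a, b] -> x < y -> 0 < t < 1 ->
  t * f x + (1 - t) * f y <= f (t * x + (1 - t) * y).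
Proof.
move=> fcont fmaj x y t; rewrite !in_itv/= => /andP[ax xb] /andP[ay yb] xy /andP[t0 t1].
rewrite leNgt; apply/negP; set z := t * x + _ => fz.
have xz : x < z by rewrite /z; nra.
have zy : z < y by rewrite /z; nra.
pose K := (f y - f x) / (y - x).
have KE : K * (y - x) = f y - f x by rewrite /K divfK// subr_eq0 gt_eqF.
have Kz : f z - (f x + K * (z - x)) < 0.
  have -> : K * (z - x) = (1 - t) * (K * (y - x)) by rewrite /z; ring.
  by rewrite KE; lra.
have zz : 0 < (z - x) * (y - z) by rewrite mulr_gt0 ?subr_gt0.
(* This [e] makes the bump at [z] half the depth of [f z] below the chord, so [w z] stays negative
   while [w] vanishes at [x] and [y]. *)
pose e := - (f z - (f x + K * (z - x))) / (2 * ((z - x) * (y - z))).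
have e0 : 0 < e by rewrite divr_gt0//; lra.
have eE : e * ((z - x) * (y - z)) = - (f z - (f x + K * (z - x))) / 2.
  by rewrite /e; field; apply/andP; split; rewrite subr_eq0 gt_eqF.
pose q s := e * ((s - x) * (y - s)) - (f x + K * (s - x)).
pose w s := f s + q s.
have wcont : {within `[x, y], continuous w}.
  apply: (@continuous_subspaceW _ _ _ `[a, b]).
    by apply: subset_itv; rewrite bnd_simp.
  move=> s; apply: cvgD; first exact: fcont.
  have qc : continuous q.
    move=> u; apply: cvgB; apply: cvgD || apply: cvgM; try exact: cvg_cst.
      by apply: cvgM; apply: cvgB; try exact: cvg_cst; exact: cvg_id.
    by apply: cvgM; first exact: cvg_cst; apply: cvgB; [exact: cvg_id|exact: cvg_cst].
  exact: (continuous_subspaceT qc).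
have [c cxy cmin] := EVT_min (ltW xy) wcont.
have wc : w c < 0.
  have := cmin z ltac:(by rewrite in_itv/= !ltW).
  by move=> /le_lt_trans; apply; rewrite /w /q eE; lra.
have wx : w x = 0 by rewrite /w /q; ring.
have wy : w y = 0 by rewrite /w /q KE; ring.
have xNc : x != c by apply: contraTneq wc => <-; rewrite wx ltxx.
have cNy : c != y by apply: contraTneq wc => ->; rewrite wy ltxx.
have {cxy} /andP[xc cy] : x < c < y.
  by move: cxy; rewrite in_itv/= !lt_neqAle xNc cNy.
have [g [dg [ddg [fg gmaj gdg dgddg ddg0]]]] := fmaj c ltac:(by rewrite in_itv/=; lra).
pose dq s := e * (x + y - 2 * s) - K.
have dqP s : is_derive s (1 : R) q (dq s).
  by apply: is_derive_eq; rewrite /dq /GRing.scale/=; ring.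
have ddqP : is_derive c (1 : R) dq (- 2 * e).
  by apply: is_derive_eq; rewrite /GRing.scale/=; ring.
(* As [g + q] lies above [w] near [c] and agrees with it at [c], it inherits the local minimum,
   although [ddg - 2 * e < 0]. *)
have : 0 <= ddg + - 2 * e.
  apply: (@second_derivative_ge0_at_min R (g + q) (dg + dq) c (ddg + - 2 * e)).
  - near=> s; have gs : is_derive s (1 : R) g (dg s) by near: s.
    exact: is_deriveD gs (dqP s).
  - near=> s.
    have : w c <= w s.
      apply: cmin; apply: subset_itv_oo_cc; near: s.
      by apply: near_in_itvoo; rewrite in_itv/= xc.
    rewrite {1}/w fg => /le_trans; apply; rewrite lerD2r.
    by near: s.
by lra.
Unshelve. all: by end_near. Qed.

(** The condition comes from [(exp g)'' = exp g * (g'' + g' ^ 2)]. *)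
Lemma expR_concave_majorant {R : realType} {f g dg : R -> R} {x ddg : R} :
  f x = g x -> (\forall s \near x, f s <= g s) ->
  (\forall s \near x, is_derive (s : R) (1 : R) g (dg s)) -> is_derive x 1 dg ddg ->
  ddg + dg x ^+ 2 <= 0 -> has_concave_majorant (expR \o f) x.
Proof.
move=> fg fleg gdg dgddg le0.
exists (expR \o g), (fun s => expR (g s) * dg s), (expR (g x) * (ddg + dg x ^+ 2)).
split.
- by rewrite /= fg.
- by near=> s; rewrite /= ler_expR; near: s.
- near=> s; have gs : is_derive s (1 : R) g (dg s) by near: s.
  exact: is_derive1_comp (is_derive_expR (g s)) gs.
- have gx : is_derive x 1 g (dg x) by apply: nbhs_singleton gdg.
  have eg : is_derive x 1 (expR \o g) (expR (g x) * dg x) by exact: is_derive1_comp.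
  have := is_deriveM eg dgddg.
  by move/is_derive_eq; apply; rewrite /GRing.scale/=; ring.
- by rewrite mulr_ge0_le0// expR_ge0.
Unshelve. all: by end_near. Qed.

(** * Minimizers in the infimum and continuity of [G] *)

Lemma G_attained {R : realType} {psi : R -> R} (e : R) :
  {within `[0, 1], continuous psi} ->
  exists2 t, t \in `[0, 1] & G psi e%:E = psi (1 - t) + t * e /\
    forall s, s \in `[0, 1] -> psi (1 - t) + t * e <= psi (1 - s) + s * e.
Proof.
move=> psi_cont.
(* The objective in the variable [s = 1 - theta], so that [psi] appears without reflection. *)
pose h s := psi s + (1 - s) * e.
have hcont : {within `[0, 1], continuous h}.
  move=> s; apply: cvgD; first exact: psi_cont.
  have lc : continuous (fun s : R => (1 - s) * e).
    move=> u; apply: cvgM; last exact: cvg_cst.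
    by apply: cvgB; [exact: cvg_cst|exact: cvg_id].
  exact: (continuous_subspaceT lc).
have [c c01 cmin] := EVT_min ler01 hcont.
have min s : s \in `[0, 1] -> psi (1 - (1 - c)) + (1 - c) * e <= psi (1 - s) + s * e.
  move=> s01; have := cmin (1 - s); rewrite /h !subKr; apply.
  by move: s01; rewrite !in_itv/=; lra.
have c01' : 1 - c \in `[0, 1] by move: c01; rewrite !in_itv/=; lra.
exists (1 - c) => //; split => //; apply/eqP; rewrite eq_le; apply/andP; split.
- apply: ge_inf; last by exists (1 - c).
  by exists (psi (1 - (1 - c)) + (1 - c) * e) => _ [s /min ? <-].
- apply: lb_le_inf; first by exists (psi (1 - (1 - c)) + (1 - c) * e), (1 - c).
  by move=> _ [s /min ? <-].
Qed.

Lemma G_le {R : realType} {psi : R -> R} (e s : R) :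
  {within `[0, 1], continuous psi} -> s \in `[0, 1] ->
  G psi e%:E <= psi (1 - s) + s * e.
Proof. by move=> psi_cont s01; have [t _ [-> ]] := G_attained e psi_cont; apply. Qed.

(** A minimizer [t] for [v] is a competitor for [u], and changes the value by [t * (u - v)] with
    [0 <= t <= 1]. *)
Lemma G_lipschitz {R : realType} {psi : R -> R} (e e' : R) :
  {within `[0, 1], continuous psi} ->
  `|G psi e%:E - G psi e'%:E| <= `|e - e'|.
Proof.
move=> psi_cont.
suff le u v : G psi u%:E - G psi v%:E <= `|u - v|.
  by rewrite ler_norml lerNl opprB le distrC le.
have [t t01 [-> _]] := G_attained v psi_cont.
have := G_le u t psi_cont t01.
move: t01; rewrite in_itv/= => /andP[t0 t1].
have := ler_norm (u - v); have := normr_ge0 (u - v); nra.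
Qed.

(** A minimizer [t < d] gives a value close to [psi 1] by continuity of [psi] at 1. If [t >= d],
    then [t * e] already exceeds [psi 1] once [e > psi 1 / d]. *)
Lemma G_cvg_pinfty {R : realType} {psi : R -> R} (eps : R) :
  (forall t, t \in `[0, 1] -> 0 <= psi t) ->
  {within `[0, 1], continuous psi} -> 0 < eps ->
  exists M, forall e, M < e -> `|psi 1 - G psi e%:E| < eps.
Proof.
move=> psi_ge0 psi_cont eps0.
have [d /= d0 hd] : exists2 d : R, 0 < d &
    forall s, s \in `[0, 1] -> 1 - s < d -> psi 1 - psi s < eps.
  have /subspace_continuousP/(_ 1) := psi_cont.
  rewrite /= in_itv/= ler01 lexx => /(_ isT)/cvgrPdist_lt/(_ _ eps0).
  move=> /nbhs_ballP[d /= d0 hd]; exists d => // s s01 sd.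
  have := hd s; rewrite /ball/= => h; apply: le_lt_trans (h _ s01).
    exact: ler_norm.
  by rewrite ger0_norm//; move: s01; rewrite in_itv/= => /andP[_]; lra.
have psi1 : 0 <= psi 1 by apply: psi_ge0; rewrite in_itv/= ler01 lexx.
exists (psi 1 / d) => e Me; rewrite -/(G psi e%:E).
have {}Me : psi 1 < e * d by rewrite -ltr_pdivrMr.
have zero01 : (0 : R) \in `[0, 1] by rewrite in_itv/= lexx ler01.
have := G_le e 0 psi_cont zero01; rewrite subr0 mul0r addr0 => Gle.
have [t t01 [GE _]] := G_attained e psi_cont.
rewrite GE ger0_norm ?subr_ge0 -?GE//.
move: (t01); rewrite in_itv/= => /andP[t0 t1].
have t01' : 1 - t \in `[0, 1] by rewrite in_itv/=; lra.
have psit := psi_ge0 _ t01'.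
have [td|dt] := ltP t d.
  have := hd _ t01'; rewrite subKr => /(_ td); nra.
nra.
Qed.

(** Finite points use the Lipschitz bound. Neighbourhoods of [+oo] also contain [+oo] itself, where
    the distance is zero; [-oo] is excluded because [G] has a dummy value there. *)
Lemma G_continuous {R : realType} {psi : R -> R} {x : \bar R} :
  (forall t, t \in `[0, 1] -> 0 <= psi t) ->
  {within `[0, 1], continuous psi} -> (-oo < x)%E ->
  {for x, continuous (G psi)}.
Proof.
move=> psi_ge0 psi_cont; case: x => [e _| _ |//].
- suff : G psi u%:E @[u --> e] --> G psi e%:E by [].
  apply/cvgrPdist_lt => eps eps0.
  near=> u; apply: le_lt_trans (G_lipschitz _ _ psi_cont) _.
  near: u; exact: cvgr_dist_lt.
- apply/(@cvgrPdist_lt _ _ _ _ (ereal_nbhs_filter +oo%E)) => eps eps0.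
  have [M hM] := G_cvg_pinfty eps psi_ge0 psi_cont eps0.
  exists M; split; first exact: num_real.
  by case=> [u|_|//]; [rewrite lte_fin => /hM|rewrite /= subrr normr0].
Unshelve. all: by end_near. Qed.

(** * Concavity in terms of convex combinations *)

Lemma concave_function_itv {R : realType} {f : R -> R} {a b : R} :
  {within `[a, b], continuous f} ->
  (forall x, x \in `]a, b[ -> has_concave_majorant f x) ->
  concave_function (`[a, b]%classic : set R) f.
Proof.
move=> fcont fmaj t x y; rewrite !in_setE /= => xab yab.
have [->|t0] := eqVneq t 0%:i01; first by rewrite !conv0.
have [->|t1] := eqVneq t 1%:i01; first by rewrite !conv1.
have {t0 t1} t01 : 0 < t%:num < 1.
  by rewrite !lt_neqAle eq_sym t0 t1 ge0 le1.
rewrite -convN lerN2 !convRE.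
(* The case [y < x] is the ordered one with weight [1 - t]. *)
have [xy|yx|<-] := ltgtP x y.
- exact: concave_of_majorants fcont fmaj _ _ _ xab yab xy t01.
- have t01' : 0 < 1 - t%:num < 1 by move/andP: t01 => [? ?]; lra.
  have := concave_of_majorants fcont fmaj _ _ _ yab xab yx t01'.
  by rewrite subKr [X in X <= _]addrC [X in _ <= f X]addrC.
- by rewrite convmm -mulrDl unstable.add_onemK mul1r.
Qed.

(** * Majorants at an interior point, by position of the minimizer *)

Lemma is_derive_derive1 {R : realType} {f : R -> R} {x : R} :
  derivable f x 1 -> is_derive x (1 : R) f (f^`()%classic x).
Proof. by rewrite derive1E; exact: derivableP. Qed.

Lemma is_derive_reflect {R : realType} {f th : R -> R} {s a b : R} :
  is_derive (1 - th s) (1 : R) f a -> is_derive s (1 : R) th b ->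
  is_derive s (1 : R) (fun u => f (1 - th u)) (a * - b).
Proof.
move=> fa thb; apply: (@is_derive1_comp R f (fun u => 1 - th u)) => //.
by rewrite -sub0r; exact: is_deriveB (is_derive_cst (1 : R) s 1) thb.
Qed.

Section majorant.
Context {R : realType} {psi : R -> R} {r0 : R} {xi : R -> \bar R} {c : R}.
Hypothesis psi_cont : {within `[0, 1], continuous psi}.
Hypothesis xi_fin : forall r, r \in `]0, r0[ -> xi r \is a fin_num.
Hypothesis xi_diff2 : twice_derivable_on `]0, r0[ (fine \o xi).
Hypothesis xi_c : forall r, 0 < r < r0 ->
  (fine \o xi)^`(2)%classic r <= c * ((fine \o xi)^`()%classic r) ^+ 2.
Context {r : R}.
Hypothesis r_in : r \in `]0, r0[.
Let X := fine \o xi.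
Let dX := X^`()%classic.
Let ddX := X^`(2)%classic r.

Let XE s : s \in `]0, r0[ -> xi s = (X s)%:E.
Proof. by move=> /xi_fin s0; rewrite /X/= fineK. Qed.

Let near_r : \forall s \near r, s \in `]0, r0[.
Proof. exact: near_in_itvoo. Qed.

Let dXP : \forall s \near r, is_derive (s : R) (1 : R) X (dX s).
Proof.
near=> s; apply: is_derive_derive1.
have s_in : s \in `]0, r0[ by near: s.
exact: (xi_diff2 s s_in).1.
Unshelve. all: by end_near. Qed.

Let dX_r : is_derive r (1 : R) X (dX r).
Proof. exact: nbhs_singleton dXP. Qed.

Let ddXP : is_derive r (1 : R) dX ddX.
Proof. exact: is_derive_derive1 (xi_diff2 r r_in).2. Qed.

Let ddX_le : ddX <= c * dX r ^+ 2.
Proof. by apply: xi_c; move: r_in; rewrite in_itv. Qed.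

(** Only admissibility of the path is checked here; the smoothness of [g] is established separately
    for each path. *)
Let G_near_le (g : R -> R) :
  (\forall s \near r, exists2 t, t \in `[0, 1] & psi (1 - t) + t * X s = g s) ->
  \forall s \near r, (G psi \o xi) s <= g s.
Proof.
move=> H; near=> s.
have [|t t01 <-] := near H s; first by [].
by rewrite /= XE; [exact: G_le|near: s].
Unshelve. all: by end_near. Qed.

Lemma majorant_at_0 : G psi (xi r) = psi 1 ->
  has_concave_majorant (expR \o (G psi \o xi)) r.
Proof.
move=> GE; apply: (@expR_concave_majorant _ _ (cst (psi 1)) (cst 0) _ 0) => //.
- apply: G_near_le; near=> s; exists 0; first by rewrite in_itv/= lexx ler01.
  by rewrite subr0 mul0r addr0.
- by near=> s; exact: is_derive_cst.
- by rewrite /cst expr0n addr0.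
Unshelve. all: by end_near. Qed.

Lemma majorant_at_1 : psi 0 = 0 -> (psi h - psi 0) / h @[h --> 0^'+] --> (0 : R) ->
  (forall s, s \in `]0, r0[ -> 0 <= X s) ->
  G psi (xi r) = X r -> (forall s, s \in `[0, 1] -> X r <= psi (1 - s) + s * X r) ->
  has_concave_majorant (expR \o (G psi \o xi)) r.
Proof.
move=> psi0 dpsi0 X_ge0 GE X_min.
(* Comparing the minimizer 1 with [1 - h] gives [h * X r <= psi h], while [psi h / h] tends to 0. *)
have Xr0 : X r = 0.
  apply/eqP; rewrite eq_le X_ge0// andbT leNgt; apply/negP => Xr_gt0.
  have : \forall h \near (0 : R)^'+, False.
    near=> h.
    have h0 : 0 < h by near: h; exact: nbhs_right_gt.
    have h1 : h < 1 by near: h; exact: nbhs_right_lt.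
    have : (psi h - psi 0) / h < X r by near: h; exact: cvgr_lt dpsi0 _ _.
    rewrite psi0 subr0 ltr_pdivrMr//.
    by have := X_min (1 - h); rewrite subKr in_itv/= => /(_ ltac:(lra)); lra.
  by move=> /filter_ex[].
have dXr0 : dX r = 0.
  have : is_derive r (1 : R) X 0.
    apply: (@derive1_at_min _ X 0 r0) => //.
    - by move: r_in; rewrite in_itv/=; lra.
    - by move=> t t_in; exact: (xi_diff2 t t_in).1.
    - by move=> t t0; rewrite Xr0 X_ge0.
  by have [_ <-] := dX_r => -[_ ->].
apply: (@expR_concave_majorant _ _ X dX _ ddX) => //.
- apply: G_near_le; near=> s; exists 1; first by rewrite in_itv/= lexx ler01.
  by rewrite subrr psi0 add0r mul1r.
(* With [dX r = 0], the hypothesis on the second derivative of [xi] reads [ddX <= 0]. *)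
- by rewrite dXr0 expr0n addr0; move: ddX_le; rewrite dXr0 expr0n mulr0.
Unshelve. all: by end_near. Qed.

(* Among the paths [th] through the minimizer [t], the slope
   [a = - xi'(r) / psi''(1 - t)] minimizes the second derivative of
   [psi (1 - th) + th * xi] at [r]. *)
Lemma majorant_inside (t : R) : twice_derivable_on `]0, 1[ psi ->
  t \in `]0, 1[ -> 0 < psi^`(2)%classic (1 - t) ->
  psi^`(2)%classic (1 - t) <= 1 / (t ^+ 2 + t * c) ->
  G psi (xi r) = psi (1 - t) + t * X r ->
  (forall s, s \in `[0, 1] -> psi (1 - t) + t * X r <= psi (1 - s) + s * X r) ->
  has_concave_majorant (expR \o (G psi \o xi)) r.
Proof.
move=> psi_diff2 t01; set p := psi^`(2)%classic _ => p0 pc GE t_min.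
have [t0 t1] : 0 < t /\ t < 1 by move: t01; rewrite in_itv/= => /andP.
pose dpsi := psi^`()%classic.
have dpsiP (s : R) : s \in `]0, 1[ -> is_derive (1 - s) (1 : R) psi (dpsi (1 - s)).
  move=> s01; apply: is_derive_derive1.
  have s01' : 1 - s \in `]0, 1[ by move: s01; rewrite !in_itv/=; lra.
  exact: (psi_diff2 _ s01').1.
have ddpsiP : is_derive (1 - t) (1 : R) dpsi p.
  apply: is_derive_derive1.
  have t01' : 1 - t \in `]0, 1[ by move: t01; rewrite !in_itv/=; lra.
  exact: (psi_diff2 _ t01').2.
(* First-order condition at the interior minimizer [t]. *)
have dpsi_t : dpsi (1 - t) = X r.
  have dh (s : R) : s \in `]0, 1[ ->
      is_derive s (1 : R) (fun s : R => psi (1 - s) + s * X r) (X r - dpsi (1 - s)).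
    move=> /dpsiP d; have dc := @is_derive_reflect _ psi id _ _ _ d (is_derive_id s 1).
    have dl : is_derive s (1 : R) (fun s : R => s * X r) (X r).
      by apply: is_derive_eq; rewrite /GRing.scale/=; ring.
    have := is_deriveD dc dl.
    by move/is_derive_eq; apply; ring.
  have [_ h0] : is_derive t (1 : R) (fun s : R => psi (1 - s) + s * X r) 0.
    apply: (@derive1_at_min _ _ 0 1) => //.
    - by move=> s /dh[].
    - by move=> s /subset_itv_oo_cc/t_min.
  by have [_] := dh t t01; rewrite h0; lra.
pose a := - dX r / p; pose th (s : R) := t + a * (s - r).
have thr : th r = t by rewrite /th subrr mulr0 addr0.
have dth s : is_derive s (1 : R) th a.
  by apply: is_derive_eq; rewrite /GRing.scale/=; ring.
have near_th : \forall s \near r, th s \in `]0, 1[.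
  have thc : {for r, continuous th}.
    by apply/differentiable_continuous/derivable1_diffP; have [] := dth r.
  by have /(_ _ (near_in_itvoo t01)) : th s @[s --> r] --> t by rewrite -thr.
pose dg (s : R) := (dpsi (1 - th s) * - a) + (th s * dX s + X s * a).
apply: (@expR_concave_majorant _ _ (fun s : R => psi (1 - th s) + th s * X s) dg _
  (p * a ^+ 2 + (2 * a * dX r + t * ddX))).
- by rewrite /= GE thr.
- apply: G_near_le; near=> s; exists (th s) => //.
  by apply: subset_itv_oo_cc; near: s.
- near=> s.
  have d1 : is_derive (1 - th s) (1 : R) psi (dpsi (1 - th s)).
    by apply: dpsiP; near: s.
  have d2 : is_derive s (1 : R) X (dX s) by near: s.
  exact: is_deriveD (@is_derive_reflect _ psi th _ _ _ d1 (dth s)) (is_deriveM (dth s) d2).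
- have d1 : is_derive (1 - th r) (1 : R) dpsi p by rewrite thr.
  have d2 := @is_derive_reflect _ dpsi th _ _ _ d1 (dth r).
  have d3 : is_derive r (1 : R) (fun s => dpsi (1 - th s) * - a) (p * a ^+ 2).
    have := is_deriveM d2 (is_derive_cst (- a) r 1).
    by move/is_derive_eq; apply; rewrite /GRing.scale/=; ring.
  have d4 := is_deriveM (dth r) ddXP.
  have d5 := is_deriveM dX_r (is_derive_cst a r 1).
  have := is_deriveD d3 (is_deriveD d4 d5).
  by move/is_derive_eq; apply; rewrite /GRing.scale/= thr; ring.
(* The two terms in [a] cancel by the first-order condition: the slope of the path does not affect
   the first derivative at [r]. *)
have -> : dg r = t * dX r by rewrite /dg thr dpsi_t; ring.
(* Inverting the bound [pc] requires [t ^+ 2 + t * c] to be positive; otherwise the claim follows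
   from [p^-1 > 0]. *)
have q_le : t ^+ 2 + t * c <= p^-1.
  have [q0|q0] := ltP 0 (t ^+ 2 + t * c).
    by rewrite -[X in X <= _]invrK lef_pV2 ?posrE ?invr_gt0// -div1r.
  by rewrite (le_trans q0)// invr_ge0 ltW.
have -> : p * a ^+ 2 + (2 * a * dX r + t * ddX) = t * ddX - dX r ^+ 2 * p^-1.
  by rewrite /a; field; rewrite gt_eqF.
(* Together: [t * ddX + (t * dX r) ^+ 2 <= (t * c + t ^+ 2) * dX r ^+ 2 <= dX r ^+ 2 / p]. *)
have : t * ddX <= t * (c * dX r ^+ 2) by rewrite ler_pM2l.
have : dX r ^+ 2 * (t ^+ 2 + t * c) <= dX r ^+ 2 * p^-1.
  by rewrite ler_wpM2l// sqr_ge0.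
rewrite exprMn; lra.
Unshelve. all: by end_near. Qed.

End majorant.

(** * Concavity of [exp (G (xi))] *)

Theorem lemma2 (R : realType) (psi : R -> R)
  (psi_ge0 : forall t, t \in `[0, 1] -> 0 <= psi t)
  (psi_convex : convex_function (`[0, 1]%classic : set R) psi)
  (psi_incr : {in `[0, 1] &, {homo psi : s t / s <= t}})
  (psi_cont : {within `[0, 1], continuous psi})
  (psi_diff2 : twice_derivable_on `]0, 1[ psi)
  (psi0 : psi 0 = 0)
  (dpsi0 : (psi h - psi 0) / h @[h --> 0^'+] --> (0 : R))
  (ddpsi_gt0 : forall t, 0 < t < 1 -> 0 < psi^`(2)%classic t)
  (r0 : R) (r0_gt0 : 0 < r0)
  (xi : R -> \bar R)
  (xi_ge0 : forall r, r \in `[0, r0] -> (0 <= xi r)%E)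
  (xi_cont : {within `[0, r0], continuous xi})
  (xi_fin : forall r, r \in `]0, r0[ -> xi r \is a fin_num)
  (xi_diff2 : twice_derivable_on `]0, r0[ (fine \o xi))
  (hc : exists c : R,
    (forall r, 0 < r < r0 ->
       (fine \o xi)^`(2)%classic r <= c * ((fine \o xi)^`()%classic r) ^+ 2) /\
    (forall t, 0 < t < 1 -> psi^`(2)%classic (1 - t) <= 1 / (t ^+ 2 + t * c))) :
  concave_function (`[0, r0]%classic : set R) (fun r => expR (G psi (xi r))).
Proof.
have [c [xi_c psi_c]] := hc.
pose X := fine \o xi.
apply: (@concave_function_itv R (expR \o (G psi \o xi)) 0 r0).
  (* At the endpoints [xi] may be [+oo], so continuity of [G] at [+oo] matters here. *)
  apply/subspace_continuousP => x x_in.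
  have xi_gtNy : (-oo < xi x)%E by apply: lt_le_trans (xi_ge0 _ x_in).
  have /subspace_continuousP/(_ x x_in) xi_x := xi_cont.
  have G_xi := cvg_comp _ _ xi_x (G_continuous psi_ge0 psi_cont xi_gtNy).
  by apply: (@cvg_comp _ _ _ _ expR); [exact: G_xi|exact: continuous_expR].
move=> r r_in.
have rE : xi r = (X r)%:E by rewrite /X/= fineK ?xi_fin.
have [t t01 [GE t_min]] := G_attained (X r) psi_cont.
rewrite -rE in GE.
have [te|tn0] := eqVneq t 0.
  apply: (majorant_at_0 psi_cont xi_fin r_in).
  by rewrite GE te subr0 mul0r addr0.
have [te|tn1] := eqVneq t 1.
  rewrite te subrr psi0 add0r mul1r in GE t_min.
  apply: (majorant_at_1 psi_cont xi_fin xi_diff2 xi_c r_in psi0 dpsi0) => // s s_in.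
  by apply: fine_ge0; apply: xi_ge0; exact: subset_itv_oo_cc.
have {tn0 tn1} t_in : 0 < t < 1.
  by move: t01; rewrite in_itv/= !lt_neqAle eq_sym tn0 tn1.
apply: (majorant_inside psi_cont xi_fin xi_diff2 xi_c r_in t psi_diff2) => //.
- by apply: ddpsi_gt0; lra.
- exact: psi_c.
Qed.
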